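(* Let $A=\{x_1,x_2\}$ be an alphabet of two variables. For every positive integer $n$, $$\sum_{\substack{0\le k\le n\\ k\equiv n\ (\mathrm{mod}\ 2)}}\binom{n}{k}\left(\frac{x_1-x_2}{2}\right)^{n-k}\left(2^k\phi_k(x_1+x_2)+2(x_1+x_2)^k\right)E_{n-k}=2^{1-n}\left((3x_1+x_2)^n+(x_1+3x_2)^n\right).$$
   Context: Here $x_1,x_2$ are two commuting variables (indeterminates) and identities are in the field of rational functions in them. The notation $\phi_n(x_1+x_2)$ denotes the function of the alphabet $\{x_1,x_2\}$ (not of the sum) given by $\phi_n(x_1+x_2)=x_1^n+x_2^n$ for $n\ge 0$; the expression $(x_1+x_2)^k$ is the ordinary power of the sum. The Euler numbers $E_n$ are defined by $\sum_{n\ge 0}E_n\frac{z^n}{n!}=\frac{2e^z}{e^{2z}+1}$. *)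

(* Defs.v *)
From HB Require Import structures.
From mathcomp Require Import all_boot all_order all_algebra.
From mathcomp Require Import fraction mpoly.

Set Implicit Arguments.
Unset Strict Implicit.
Unset Printing Implicit Defensive.

Import GRing.Theory.
Local Open Scope ring_scope.

(* A formal power series over rat is represented by its coefficient sequence. *)
Definition fps := nat -> rat.

Definition fps1 : fps := fun n => (n == 0)%:R.

Definition fps_add (f g : fps) : fps := fun n => f n + g n.

Definition fps_scale (c : rat) (f : fps) : fps := fun n => c * f n.

Definition fps_mul (f g : fps) : fps :=
  fun n => \sum_(i < n.+1) f i * g (n - i)%N.

(* The exponential series e^(c z). *)
Definition fps_exp (c : rat) : fps := fun n => c ^+ n / n`!%:R.

(* The exponential generating function of the sequence a. *)
Definition fps_egf (a : nat -> rat) : fps := fun n => a n / n`!%:R.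

(* First n coefficients of f / g, computed by long division; meaningful when
   g 0 != 0, see fps_divK and fps_div_uniq. *)
Fixpoint fps_div_seq (f g : fps) (n : nat) : seq rat :=
  if n is m.+1 then
    let s := fps_div_seq f g m in
    rcons s ((f m - \sum_(i < m) s`_i * g (m - i)%N) / g 0)
  else [::].

Definition fps_div (f g : fps) : fps := fun n => (fps_div_seq f g n.+1)`_n.

Lemma size_fps_div_seq f g n : size (fps_div_seq f g n) = n.
Proof. by elim: n => //= n IHn; rewrite size_rcons IHn. Qed.

Lemma nth_fps_div_seq f g n i :
  (i < n)%N -> (fps_div_seq f g n)`_i = fps_div f g i.
Proof.
elim: n => // n IHn; rewrite ltnS leq_eqVlt => /predU1P[-> // | lt_in].
by rewrite [fps_div_seq f g n.+1]/= nth_rcons size_fps_div_seq lt_in IHn.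
Qed.

Lemma fps_divE f g n :
  fps_div f g n = (f n - \sum_(i < n) fps_div f g i * g (n - i)%N) / g 0.
Proof.
rewrite {1}/fps_div [fps_div_seq f g n.+1]/= nth_rcons size_fps_div_seq.
rewrite ltnn eqxx; congr ((_ - _) / _).
by apply: eq_bigr => i _; rewrite nth_fps_div_seq.
Qed.

Lemma fps_divK f g : g 0 != 0 -> fps_mul (fps_div f g) g =1 f.
Proof.
move=> g0 n; rewrite /fps_mul big_ord_recr /= subnn [fps_div f g n]fps_divE.
by rewrite divfK // addrC subrK.
Qed.

Lemma fps_div_uniq f g q :
  g 0 != 0 -> fps_mul q g =1 f -> q =1 fps_div f g.
Proof.
move=> g0 qg n; elim/ltn_ind: n => n IHn.
rewrite fps_divE -qg /fps_mul big_ord_recr /= subnn.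
rewrite (eq_bigr (fun i : 'I_n => fps_div f g i * g (n - i)%N)).
  by rewrite addrAC subrr add0r mulfK.
by move=> i _; rewrite IHn.
Qed.

(* n! times the coefficient of z^n in 2 e^z / (e^(2 z) + 1). *)
Definition euler_number (n : nat) : rat :=
  n`!%:R * fps_div (fps_scale 2 (fps_exp 1)) (fps_add (fps_exp 2) fps1) n.

Lemma euler_number_egf :
  fps_egf euler_number
  =1 fps_div (fps_scale 2 (fps_exp 1)) (fps_add (fps_exp 2) fps1).
Proof.
move=> n; rewrite /fps_egf /euler_number mulrC mulKf //.
by rewrite Num.Theory.pnatr_eq0 -lt0n fact_gt0.
Qed.

Lemma euler_number_egf_mul :
  fps_mul (fps_egf euler_number) (fps_add (fps_exp 2) fps1)
  =1 fps_scale 2 (fps_exp 1).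
Proof.
set f := fps_scale _ _; set g := fps_add _ _ => n.
rewrite -[RHS](@fps_divK f g) //.
by apply: eq_bigr => i _; rewrite euler_number_egf.
Qed.

Definition ratfun2 (K : fieldType) : fieldType := {fraction {mpoly K[2]}}.

Definition x1 (K : fieldType) : ratfun2 K := tofrac ('X_(0 : 'I_2) : {mpoly K[2]}).
Definition x2 (K : fieldType) : ratfun2 K := tofrac ('X_(1 : 'I_2) : {mpoly K[2]}).

(* The power sum of the alphabet {a, b}, a function of the pair of letters and
   not of their sum a + b. *)
Definition phi (L : fieldType) (n : nat) (a b : L) : L := a ^+ n + b ^+ n.

(* Main.v *)
(** Let [E] denote the umbra [E^n -> E_n], that is, the linear functional on
    polynomials with [X^n -> E_n].  The defining generating function gives
    [(E + 2)^n + E^n = 2], hence [p(E + 1) + p(E - 1) = 2 p(0)] for every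
    polynomial [p].  With [d = (x1 - x2) / 2] and [s = x1 + x2], so that
    [2 x1 = s + 2 d] and [2 x2 = s - 2 d], the left-hand side is
    [(d E + s + 2 d)^n + 2 (d E + s)^n + (d E + s - 2 d)^n]; the parity
    restriction is harmless because [E_n = 0] for odd [n].  Applying the above
    to [p = (d X + s + d)^n] and to [p = (d X + s - d)^n] evaluates it as
    [2 (s + d)^n + 2 (s - d)^n], where [s + d = (3 x1 + x2) / 2] and
    [s - d = (x1 + 3 x2) / 2]. *)
Require Import Defs.
From HB Require Import structures.
From mathcomp Require Import all_boot all_order all_algebra.
From mathcomp Require Import fraction mpoly ring.

Import GRing.Theory.
Local Open Scope ring_scope.

(** In characteristic 0 nonzero integers stay nonzero in [L], so fractions can be cross-multiplied
    there as in [rat]. *)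
Lemma char0_ratr_rmorphism (L : fieldType) (char0 : [pchar L] =i pred0) :
  exists f : {rmorphism rat -> L}, f =1 ratr.
Proof.
have natr_eq0 := (pcharf0P L).1 char0.
have intr_neq0 (z : int) : z != 0 -> z%:~R != 0 :> L.
  case: z => k; first by rewrite -pmulrn natr_eq0.
  by move=> _; rewrite NegzE mulrNz oppr_eq0 -pmulrn natr_eq0.
(* [ratr] may be read off any fraction [n / d] equal to [x], reduced or not; sums and products then
   use the product of the two denominators. *)
have ratrE (x : rat) (n d : int) :
    d != 0 -> x * d%:~R = n%:~R -> ratr x = n%:~R / d%:~R :> L.
  move=> d0 xd; have den0 := denq_neq0 x.
  apply/eqP; rewrite eqr_div ?intr_neq0 // -!rmorphM; apply/eqP; congr _%:~R.
  apply/eqP; rewrite -(eqr_int rat) !rmorphM /= -xd numqE.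
  by rewrite mulrAC.
have ratr_zmod : zmod_morphism (@ratr L).
  move=> x y; have [dx dy] := (denq_neq0 x, denq_neq0 y).
  rewrite (@ratrE (x - y) (numq x * denq y - numq y * denq x)
            (denq x * denq y)) ?mulf_neq0 //.
    by rewrite /ratr rmorphB !rmorphM /=; field; rewrite !intr_neq0.
  by rewrite rmorphB !rmorphM /= !numqE; ring.
have ratr_monoid : monoid_morphism (@ratr L).
  split; first by rewrite -[1]/(1%:R) ratr_nat.
  move=> x y; have [dx dy] := (denq_neq0 x, denq_neq0 y).
  rewrite (@ratrE (x * y) (numq x * numq y) (denq x * denq y)) ?mulf_neq0 //.
    by rewrite /ratr !rmorphM /=; field; rewrite !intr_neq0.
  by rewrite !rmorphM /= !numqE; ring.
pose add := GRing.isZmodMorphism.Build rat L (@ratr L) ratr_zmod.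
pose mul := GRing.isMonoidMorphism.Build rat L (@ratr L) ratr_monoid.
pose f : {rmorphism rat -> L} := HB.pack (@ratr L) add mul.
by exists f.
Qed.

(** Compare the coefficients of [z^n] in [E(z) (e^(2 z) + 1) = 2 e^z] and multiply by [n!]. *)
Lemma euler_number_rec (n : nat) :
  \sum_(i < n.+1) 'C(n, i)%:R * 2 ^+ (n - i) * euler_number i + euler_number n
  = 2.
Proof.
have fact_neq0 m : m`!%:R != 0 :> rat.
  by rewrite Num.Theory.pnatr_eq0 -lt0n fact_gt0.
have := euler_number_egf_mul n; rewrite /fps_mul /fps_scale /fps_exp expr1n.
move=> /(congr1 ( *%R n`!%:R)); rewrite [RHS]mulrCA div1r divff // mulr1 => egf2.
(* The series [1] contributes only at [i = n]; an indicator brings that term under the sum, so that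
   the two sides match termwise. *)
rewrite -[RHS]egf2 mulr_sumr; transitivity (\sum_(i < n.+1)
   ('C(n, i)%:R * 2 ^+ (n - i) * euler_number i
    + (i == n :> nat)%:R * euler_number n)).
  rewrite big_split /=; congr (_ + _).
  rewrite big_ord_recr /= eqxx mul1r big1 ?add0r // => i _.
  by rewrite ltn_eqF ?mul0r.
apply: eq_bigr => i _; rewrite /fps_egf /fps_add /fps_exp /fps1.
have le_in : (i <= n)%N by rewrite -ltnS.
rewrite subn_eq0 (_ : (n <= i)%N = (i == n :> nat)); last first.
  by rewrite eqn_leq le_in.
rewrite -(bin_fact le_in) !natrM mulrDr mulrDr; congr (_ + _).
  by field; rewrite !fact_neq0.
case: eqP => [-> | _]; last by rewrite !(mul0r, mulr0).
by rewrite binn subnn fact0 mulr1n; field; rewrite fact_neq0.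
Qed.

Lemma ratr_euler_number_rec (L : fieldType) (char0 : [pchar L] =i pred0)
    (n : nat) :
  \sum_(i < n.+1) 'C(n, i)%:R * 2 ^+ (n - i) * ratr (euler_number i)
    + ratr (euler_number n) = 2 :> L.
Proof.
have [f fE] := char0_ratr_rmorphism L char0.
rewrite -[RHS](rmorph_nat f 2) -(euler_number_rec n) rmorphD rmorph_sum /= fE.
congr (_ + _); apply: eq_bigr => i _.
rewrite -fE; move: (euler_number i) => E.
by rewrite !rmorphM /= rmorphXn /= !rmorph_nat.
Qed.

Definition umbra (L : fieldType) (e : nat -> L) (p : {poly L}) : L :=
  \sum_(i < size p) p`_i * e i.
Arguments umbra {L} e p.

Section Umbra.
Variables (L : fieldType) (e : nat -> L).

Lemma umbra_widen (m : nat) (p : {poly L}) :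
  (size p <= m)%N -> umbra e p = \sum_(i < m) p`_i * e i.
Proof.
move=> le_pm; rewrite /umbra (big_ord_widen m (fun i => p`_i * e i)) //.
rewrite big_mkcond /=; apply: eq_bigr => i _.
by case: ltnP => // /(nth_default 0) ->; rewrite mul0r.
Qed.

Lemma umbra_is_linear : linear_for *%R (umbra e).
Proof.
move=> a p q; pose m := maxn (size (a *: p + q)) (maxn (size p) (size q)).
rewrite !(umbra_widen m) ?leq_max ?leqnn ?orbT //.
rewrite mulr_sumr -big_split; apply: eq_bigr => i _ /=.
by rewrite coefD coefZ mulrDl mulrA.
Qed.

HB.instance Definition _ :=
  GRing.isLinear.Build L {poly L} L *%R (umbra e) umbra_is_linear.

Lemma umbraXn (n : nat) : umbra e 'X^n = e n.
Proof.
rewrite /umbra size_polyXn big_ord_recr /= coefXn eqxx mul1r big1 ?add0r //.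
by move=> i _; rewrite coefXn ltn_eqF ?mul0r.
Qed.

Lemma umbra_binomial (c d : L) (n : nat) :
  umbra e ((d *: 'X + c%:P) ^+ n)
  = \sum_(k < n.+1) 'C(n, k)%:R * d ^+ (n - k) * c ^+ k * e (n - k).
Proof.
rewrite exprDn linear_sum; apply: eq_bigr => k _ /=.
rewrite exprZn -polyC_exp mulrC mul_polyC scalerA -scaler_nat scalerA.
by rewrite linearZ /= umbraXn; ring.
Qed.

End Umbra.

Section EulerUmbra.
Variables (L : fieldType) (two_neq0 : 2 != 0 :> L) (e : nat -> L).
Hypothesis euler_rec : forall n,
  \sum_(i < n.+1) 'C(n, i)%:R * 2 ^+ (n - i) * e i + e n = 2.

Lemma umbra_XaddC (g : nat -> L) (n : nat) :
  umbra g (('X + 2%:P) ^+ n)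
  = \sum_(i < n.+1) 'C(n, i)%:R * 2 ^+ (n - i) * g i.
Proof.
rewrite addrC exprDn linear_sum; apply: eq_bigr => i _ /=.
by rewrite -polyC_exp mul_polyC -scaler_nat scalerA linearZ /= umbraXn.
Qed.

(** By linearity it suffices to take [p = 'X^i], where this is [euler_rec]. *)
Lemma umbra_euler_shift2 (p : {poly L}) :
  umbra e (p \Po ('X + 2%:P)) + umbra e p = 2 * p.[1].
Proof.
rewrite -[p]coefK poly_def; set m := size p.
rewrite !linear_sum -big_split horner_sum mulr_sumr /=.
apply: eq_bigr => i _; rewrite linearZ !linearZ /= comp_Xn_poly.
rewrite umbraXn umbra_XaddC -mulrDr euler_rec hornerZ hornerXn expr1n.
by rewrite mulr1 mulrC.
Qed.

Lemma umbra_euler_shift1 (p : {poly L}) :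
  umbra e (p \Po ('X + 1%:P)) + umbra e (p \Po ('X - 1%:P)) = 2 * p.[0].
Proof.
have := umbra_euler_shift2 (p \Po ('X - 1%:P)).
rewrite -comp_polyA horner_comp !hornerE subrr => <-.
congr (umbra e (_ \Po _) + _).
rewrite comp_polyB comp_polyX comp_polyC -addrA -polyCB; congr (_ + _%:P).
by ring.
Qed.

(** The unknown [g n] occurs twice, as the term [i = n] and as the extra summand, so its total
    coefficient is the invertible [2] and the earlier values determine it. *)
Lemma euler_rec_uniq (g : nat -> L) :
  (forall n, \sum_(i < n.+1) 'C(n, i)%:R * 2 ^+ (n - i) * g i + g n = 2) ->
  g =1 e.
Proof.
move=> g_rec; elim/ltn_ind => n IHn.
have := etrans (g_rec n) (esym (euler_rec n)).
rewrite !big_ord_recr /= binn subnn !mul1r.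
rewrite (eq_bigr (fun i : 'I_n => 'C(n, i)%:R * 2 ^+ (n - i) * e i)).
  move: (\sum_(i < n) _) (g n) (e n) => S u v eq_uv.
  apply: (mulfI two_neq0); apply: (addrI S).
  by rewrite ![2 * _]mulr_natl !mulr2n !addrA.
by move=> i _; rewrite IHn.
Qed.

(* By uniqueness, [E] and [- E] are the same umbra. *)
Lemma euler_odd (n : nat) : odd n -> e n = 0.
Proof.
move=> odd_n; pose g i := (-1) ^+ i * e i.
have umbraN (p : {poly L}) : umbra g p = umbra e (p \Po - 'X).
  rewrite -{2}[p]coefK poly_def !linear_sum; apply: eq_bigr => i _ /=.
  rewrite linearZ linearZ /= comp_Xn_poly -scaleN1r exprZn.
  by rewrite linearZ /= umbraXn.
have /(_ n) : g =1 e.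
  apply: euler_rec_uniq => m; rewrite -umbra_XaddC -[g m]umbraXn !umbraN.
  (* This polynomial is [('X + 2) ^+ m] at [- 'X], its shift by 2 is [(- 'X) ^+ m], and its value at
     1 is 1. *)
  have := umbra_euler_shift2 ((2%:P - 'X) ^+ m).
  rewrite !hornerE (_ : 2 - 1 = 1 :> L); last by ring.
  rewrite expr1n mulr1 addrC => shift.
  rewrite -[RHS]shift; congr (umbra e _ + umbra e _).
    by rewrite rmorphXn /= rmorphD /= comp_polyX comp_polyC addrC.
  rewrite comp_Xn_poly rmorphXn /= rmorphB /= comp_polyX comp_polyC.
  by congr (_ ^+ m); ring.
rewrite /g -signr_odd odd_n expr1 mulN1r => /eqP.
rewrite eq_sym -addr_eq0 -mulr2n -mulr_natl mulf_eq0 (negPf two_neq0).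
by move/eqP.
Qed.

Lemma umbra_euler_affine (a d : L) (n : nat) :
  umbra e ((d *: 'X + (a + d)%:P) ^+ n) + umbra e ((d *: 'X + (a - d)%:P) ^+ n)
  = 2 * a ^+ n.
Proof.
have := umbra_euler_shift1 ((d *: 'X + a%:P) ^+ n).
rewrite !hornerE => <-; congr (umbra e _ + umbra e _); rewrite rmorphXn /=;
  congr (_ ^+ n); rewrite comp_polyD comp_polyZ comp_polyX comp_polyC;
  by rewrite -!mul_polyC !polyCD ?polyCN; ring.
Qed.

Lemma euler_power_sum_identity (x y : L) (n : nat) :
  \sum_(0 <= k < n.+1 | k == n %[mod 2])
     'C(n, k)%:R * ((x - y) / 2) ^+ (n - k)
     * (2 ^+ k * phi k x y + 2 * (x + y) ^+ k) * e (n - k)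
  = 2 ^ (1 - n%:Z) * ((3 * x + y) ^+ n + (x + 3 * y) ^+ n).
Proof.
set d := (x - y) / 2.
transitivity (umbra e ((d *: 'X + (2 * x)%:P) ^+ n)
    + umbra e ((d *: 'X + (x + y)%:P) ^+ n)
    + (umbra e ((d *: 'X + (x + y)%:P) ^+ n)
    + umbra e ((d *: 'X + (2 * y)%:P) ^+ n))).
  rewrite !umbra_binomial -!big_split big_mkord big_mkcond /=.
  apply: eq_bigr => k _; have le_kn : (k <= n)%N by rewrite -ltnS.
  rewrite !modn2 (inj_eq (can_inj oddb)); case: ifP => [_ | kn].
    by rewrite /phi !exprMn; ring.
  (* For the indices left out of the sum, [n - k] is odd. *)
  rewrite euler_odd ?oddB //; first by ring.
  by case: (odd n) (odd k) kn => [] [].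
have -> : 2 * x = (3 * x + y) / 2 + d by rewrite /d; field.
have -> : 2 * y = (x + 3 * y) / 2 - d by rewrite /d; field.
(* The two copies of [x + y] are written differently: one pairs with [2 * x] around
   [(3 * x + y) / 2], the other with [2 * y] around [(x + 3 * y) / 2]. *)
have s1 : x + y = (3 * x + y) / 2 - d by rewrite /d; field.
have s2 : x + y = (x + 3 * y) / 2 + d by rewrite /d; field.
rewrite {1}s1 s2 !umbra_euler_affine -mulrDr !expr_div_n -mulrDl mulrCA.
by rewrite expfzDr // expr1z -exprnN mulrC mulrAC.
Qed.

End EulerUmbra.

Theorem theorem9 (K : fieldType) (char0 : [pchar K] =i pred0)
    (n : nat) (n_gt0 : (0 < n)%N) :
  \sum_(0 <= k < n.+1 | k == n %[mod 2])
     'C(n, k)%:R * ((x1 K - x2 K) / 2) ^+ (n - k)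
     * (2 ^+ k * phi k (x1 K) (x2 K) + 2 * (x1 K + x2 K) ^+ k)
     * ratr (euler_number (n - k))
  = 2 ^ (1 - n%:Z)
    * ((3 * x1 K + x2 K) ^+ n + (x1 K + 3 * x2 K) ^+ n).
Proof.
(* Constants embed injectively into polynomials and then into fractions, so the characteristic is
   that of [K]. *)
have charL : [pchar ratfun2 K] =i pred0.
  apply/pcharf0P => m.
  rewrite -(rmorph_nat (@tofrac {mpoly K[2]})) tofrac_eq0 -mpolyC_nat.
  by rewrite mpolyC_eq0 ((pcharf0P _).1 char0).
apply: (euler_power_sum_identity _ _ _ (ratr_euler_number_rec _ charL)).
by rewrite ((pcharf0P _).1 charL).
Qed.
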